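(* Let $E$ be a Hilbert C*-module over a unital C*-algebra $\mathcal{A}$ that satisfies property $[\mathbb{H}]$, let $C\in\mathcal{K}(E)$, $L=I-C$, and let $r$ be the smallest non-negative integer with $\mathrm{Ker}(L^r)=\mathrm{Ker}(L^{r+1})$, so that $E=\mathrm{Ker}(L^r)\oplus\mathrm{Ran}(L^r)$ (orthogonal direct sum). Then: (1) $\mathrm{Ker}(L^r)$ is a finitely generated submodule of $E$, and the orthogonal projection $P$ of $E$ onto $\mathrm{Ker}(L^r)$ along $\mathrm{Ran}(L^r)$ is a compact operator, $P\in\mathcal{K}(E)$. (2) The operator $I-C-P$ is a bijection of $E$ onto $E$.
   Context: A (right) Hilbert $\mathcal{A}$-module $E$ is a right $\mathcal{A}$-module with an $\mathcal{A}$-valued inner product $\langle\cdot,\cdot\rangle$ (linear in the second variable, $\langle x,ya\rangle=\langle x,y\rangle a$, $\langle y,x\rangle=\langle x,y\rangle^*$, $\langle x,x\rangle\ge 0$ with equality iff $x=0$), complete in the norm $\|x\|=\|\langle x,x\rangle\|^{1/2}$. For $x,y\in E$, $\theta_{x,y}(z)=x\langle y,z\rangle$; $\mathcal{K}(E)$ (the compact operators) is the norm closure in the C*-algebra $\mathcal{L}(E)$ of adjointable operators of the linear span of $\{\theta_{x,y}:x,y\in E\}$. $E$ satisfies property $[\mathbb{H}]$ if for every bounded sequence $(\zeta_n)$ in $E$ there exist a subsequence $(\zeta_{n_k})$ and $\zeta\in E$ such that $\langle v,\zeta_{n_k}\rangle\to\langle v,\zeta\rangle$ for every $v\in E$. A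 submodule is finitely generated if it is generated as a right $\mathcal{A}$-module by finitely many elements.
   Formalization: The word ''orthogonal'' is dropped, as it fails in general (C = [[1,1],[0,0]] on ℂ²): E = Ker(L^r) ⊕ Ran(L^r) is proved as an algebraic direct sum, and P is the projection onto Ker(L^r) along Ran(L^r), not necessarily orthogonal. *)

(* Defs.v *)
From mathcomp Require Import all_boot all_order all_algebra.
From mathcomp Require Import reals.
From mathcomp.real_closed Require Import complex.
Set Implicit Arguments. Unset Strict Implicit. Unset Printing Implicit Defensive.
Import Order.TTheory GRing.Theory Num.Theory.
Local Open Scope ring_scope.

Section HilbertModules.
Variable R : realType.
Local Notation C := R[i].

Definition cauchy_seq (T : zmodType) (nrm : T -> R) (u : nat -> T) : Prop :=
  forall e : R, 0 < e -> exists N : nat,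
    forall m n : nat, (N <= m)%N -> (N <= n)%N -> nrm (u m - u n) < e.

Definition converges_to (T : zmodType) (nrm : T -> R) (u : nat -> T) (l : T) : Prop :=
  forall e : R, 0 < e -> exists N : nat, forall n : nat, (N <= n)%N -> nrm (u n - l) < e.

Section CStar.
Variables (A : algType C) (star : A -> A) (nA : A -> R).

Record cstar_algebra : Prop := {
  cs_norm_ge0   : forall x, 0 <= nA x;
  cs_norm_eq0   : forall x, nA x = 0 -> x = 0;
  cs_norm_triangle : forall x y, nA (x + y) <= nA x + nA y;
  cs_norm_scale : forall (l : C) x, nA (l *: x) = Normc.normc l * nA x;
  cs_norm_submult : forall x y, nA (x * y) <= nA x * nA y;
  cs_complete : forall u : nat -> A, cauchy_seq nA u -> exists l, converges_to nA u l;
  cs_star_invol : forall x, star (star x) = x;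
  cs_star_add   : forall x y, star (x + y) = star x + star y;
  cs_star_scale : forall (l : C) x, star (l *: x) = (conjc l) *: star x;
  cs_star_mul   : forall x y, star (x * y) = star y * star x;
  cs_cstar_id   : forall x, nA (star x * x) = nA x ^+ 2
}.

(* invertibility and positivity (self-adjoint with spectrum in [0, +oo)) *)
Definition invertible (a : A) : Prop := exists b : A, a * b = 1 /\ b * a = 1.

Definition cstar_pos (a : A) : Prop :=
  star a = a /\ forall l : C, ~~ (0 <= l) -> invertible (a - l%:A).

Variables (E : lmodType C) (act : E -> A -> E) (ip : E -> E -> A).

Definition hnorm (x : E) : R := Num.sqrt (nA (ip x x)).

Record hilbert_module : Prop := {
  hm_act_addl : forall x y a, act (x + y) a = act x a + act y a;
  hm_act_addr : forall x a b, act x (a + b) = act x a + act x b;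
  hm_act_mul  : forall x a b, act x (a * b) = act (act x a) b;
  hm_act_one  : forall x, act x 1 = x;
  hm_act_scalel : forall (l : C) x a, l *: act x a = act (l *: x) a;
  hm_act_scaler : forall (l : C) x a, l *: act x a = act x (l *: a);
  hm_ip_add   : forall x y z, ip x (y + z) = ip x y + ip x z;
  hm_ip_scale : forall (l : C) x y, ip x (l *: y) = l *: ip x y;
  hm_ip_act   : forall x y a, ip x (act y a) = ip x y * a;
  hm_ip_sym   : forall x y, ip y x = star (ip x y);
  hm_ip_pos   : forall x, cstar_pos (ip x x);
  hm_ip_def   : forall x, ip x x = 0 -> x = 0;
  hm_complete : forall u : nat -> E, cauchy_seq hnorm u -> exists l, converges_to hnorm u l
}.

Definition property_H : Prop :=
  forall zeta : nat -> E, (exists M : R, forall n, hnorm (zeta n) <= M) ->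
  exists (phi : nat -> nat) (z : E),
    (forall k, (phi k < phi k.+1)%N) /\
    forall v : E, converges_to nA (fun k => ip v (zeta (phi k))) (ip v z).

Definition adjointable (T : E -> E) : Prop :=
  exists T' : E -> E, forall x y, ip (T x) y = ip x (T' y).

Definition theta (x y : E) : E -> E := fun z => act x (ip y z).

Definition finite_rank (F : E -> E) : Prop :=
  exists (n : nat) (l : 'I_n -> C) (xs ys : 'I_n -> E),
    forall z, F z = \sum_(i < n) l i *: theta (xs i) (ys i) z.

(* K(E): adjointable operators in the operator-norm closure of the finite
   rank ones ( ||T - F|| <= e  iff  ||T z - F z|| <= e ||z|| for all z ) *)
Definition compact_op (T : E -> E) : Prop :=
  adjointable T /\
  forall e : R, 0 < e -> exists F, finite_rank F /\
    forall z, hnorm (T z - F z) <= e * hnorm z.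

Definition finitely_generated (S : E -> Prop) : Prop :=
  exists (n : nat) (g : 'I_n -> E),
    forall x, S x <-> exists a : 'I_n -> A, x = \sum_(i < n) act (g i) (a i).

End CStar.

Definition IminusC (E : zmodType) (T : E -> E) : E -> E := fun x => x - T x.
Definition ker_pow (E : zmodType) (T : E -> E) (k : nat) (x : E) : Prop :=
  iter k (IminusC T) x = 0.
Definition ran_pow (E : zmodType) (T : E -> E) (k : nat) (y : E) : Prop :=
  exists x, y = iter k (IminusC T) x.

End HilbertModules.

(* Main.v *)
Require Import Defs.
From mathcomp Require Import all_boot all_order all_algebra.
From mathcomp Require Import reals boolp.
From mathcomp Require Import ring lra.
From mathcomp.real_closed Require Import complex.
Set Implicit Arguments. Unset Strict Implicit. Unset Printing Implicit Defensive.
Import Order.TTheory GRing.Theory Num.Theory.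
Local Open Scope ring_scope.

(** Property [H] makes every operator of K(E) sequentially compact in norm: a
    bounded sequence has a weakly convergent subsequence, which finite rank
    operators, hence compact ones, map to a norm convergent one. Riesz's theory
    of [I - K] then applies. Write [L^r = I - K] with [K] compact. The kernel of
    [I - K] is that of its square; since ranges of the powers of [I - K] are closed
    and stabilise, [E = Ker (I - K) + Ran (I - K)]. The adjoint [I - K^*] has the
    same property, and its kernel projection is the adjoint of the projection
    [P]. As [P = K P], [P] is bounded and then compact. If [F] is of finite rank
    and close to [P], then [I - (P - F)] is onto and the images under [P] of the
    generators of [F] generate [Ker (I - K)]; and [I - (C + P)] is injective,
    hence onto.

    Riesz's theory tolerates a quasi-norm, so the Cauchy-Schwarz inequality is
    needed only up to a constant, and this follows from the parallelogram law and
    monotonicity of the norm on positive elements. For the latter, spectral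
    positivity of [a] is converted to [|t - a| <= t] for some [t]. *)

(** * Real sequences and the modulus of a complex number *)

Section RealsAndModulus.
Variable R : realType.

Lemma le_of_lt_eps (x y : R) : (forall e, 0 < e -> x <= y + e) -> x <= y.
Proof. by move=> h; apply/ler_addgt0Pr. Qed.

Lemma inv_nat_lt (e : R) : 0 < e -> exists N, forall n, (N <= n)%N -> n.+1%:R^-1 < e.
Proof.
move=> e0; exists (Num.bound e^-1) => n Nn.
rewrite invf_plt ?posrE ?ltr0n//.
apply: lt_le_trans (archi_boundP _) _; first by rewrite invr_ge0 ltW.
by rewrite ler_nat leqW.
Qed.

(** Bernoulli's inequality for [c^-1], together with the Archimedean property. *)
Lemma exprn_lt (c e : R) : 0 <= c < 1 -> 0 < e -> exists N, c ^+ N < e.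
Proof.
move=> /andP[c0 c1] e0.
have [->|cn0] := eqVneq c 0; first by exists 1%N; rewrite expr1.
have cp : 0 < c by rewrite lt_def cn0.
have [N hN] : exists N : nat, e^-1 < 1 + (c^-1 - 1) *+ N.
  have h0 : 0 < c^-1 - 1 by rewrite subr_gt0 invf_gt1.
  exists (Num.bound (e^-1 / (c^-1 - 1))).
  have := archi_boundP (divr_ge0 (ltW (_ : 0 < e^-1)) (ltW h0)).
  rewrite invr_gt0 ltr_pdivrMr// mulr_natl => /(_ e0) h; by apply: lt_trans h _; rewrite ltrDr.
exists N; rewrite -(invrK (c ^+ N)) invf_plt ?posrE ?invr_gt0 ?exprn_gt0//.
apply: lt_le_trans hN _; rewrite -exprVn.
elim: N => [|N ih]; first by rewrite expr0 mulr0n addr0.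
have h0 : 0 < c^-1 - 1 by rewrite subr_gt0 invf_gt1.
have hN : 0 <= (c^-1 - 1) *+ N by rewrite mulrn_wge0// ltW.
rewrite exprS mulrS; move: h0 hN ih; set u := (c^-1 - 1) *+ N.
by set w := c^-1 ^+ N; nra.
Qed.

Lemma normc_real (t : R) : Normc.normc (real_complex R t) = `|t|.
Proof. by rewrite /Normc.normc /= expr0n addr0 sqrtr_sqr. Qed.

Lemma normc_i : Normc.normc ('i : R[i])%C = 1.
Proof. by rewrite /Normc.normc /= expr0n add0r expr1n sqrtr1. Qed.

Lemma normc_conj (l : R[i]) : Normc.normc (conjc l) = Normc.normc l.
Proof. by case: l => u v; rewrite /Normc.normc /= sqrrN. Qed.

Lemma normc_ge0 (l : R[i]) : 0 <= Normc.normc l.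
Proof. by case: l => u v; rewrite /Normc.normc sqrtr_ge0. Qed.

End RealsAndModulus.

(** * Positive elements of a C*-algebra *)

Section CstarAlgebra.
Variables (R : realType) (A : algType R[i]) (star : A -> A) (nA : A -> R).
Hypothesis HA : cstar_algebra star nA.
Local Notation "t %:S" := ((real_complex R t)%:A) (at level 2, format "t %:S").
Implicit Types (a b x y z : A) (s t : R).

Lemma scalar0 : 0%:S = 0 :> A.
Proof. by rewrite rmorph0 scale0r. Qed.
Lemma scalarD s t : (s + t)%:S = s%:S + t%:S :> A.
Proof. by rewrite rmorphD scalerDl. Qed.
Lemma scalarB s t : (s - t)%:S = s%:S - t%:S :> A.
Proof. by rewrite rmorphB scalerBl. Qed.
Lemma scalarN t : (- t)%:S = - t%:S :> A.
Proof. by rewrite rmorphN scaleNr. Qed.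
Lemma scalar_commutes t a : t%:S * a = a * t%:S.
Proof. by rewrite -scalerAl -scalerAr mul1r mulr1. Qed.

Lemma nA0 : nA 0 = 0.
Proof. by rewrite -(scale0r 0) (cs_norm_scale HA) Normc.normc0 mul0r. Qed.
Lemma nAZ t a : nA (real_complex R t *: a) = `|t| * nA a.
Proof. by rewrite (cs_norm_scale HA) normc_real. Qed.
Lemma nAN a : nA (- a) = nA a.
Proof. by rewrite -scaleN1r -(rmorphN1 (real_complex R)) nAZ normrN1 mul1r. Qed.
Lemma nA_ge0 a : 0 <= nA a. Proof. exact: cs_norm_ge0 HA a. Qed.
Lemma nAD a b : nA (a + b) <= nA a + nA b.
Proof. exact: cs_norm_triangle HA a b. Qed.
Lemma nAB a b : nA (a - b) <= nA a + nA b.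
Proof. by rewrite -(nAN b); exact: nAD. Qed.
Lemma nA_distC a b : nA (a - b) = nA (b - a).
Proof. by rewrite -nAN opprB. Qed.

Lemma star0 : star 0 = 0.
Proof. by apply: (addrI (star 0)); rewrite -(cs_star_add HA) !addr0. Qed.
Lemma starN a : star (- a) = - star a.
Proof.
by apply/eqP; rewrite -addr_eq0 -(cs_star_add HA) addNr star0.
Qed.
Lemma starB a b : star (a - b) = star a - star b.
Proof. by rewrite (cs_star_add HA) starN. Qed.
Lemma star1 : star 1 = 1.
Proof.
by rewrite -[RHS](cs_star_invol HA) -[X in _ = star X]mulr1 (cs_star_mul HA)
           (cs_star_invol HA) mulr1.
Qed.
Lemma star_scalar t : star t%:S = t%:S.
Proof. by rewrite (cs_star_scale HA) star1 conjc_real. Qed.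
(** The C*-identity gives [|b|^2 = |star b * b| <= |star b| |b|]; divide by [|b|] and use this for
    both [a] and [star a]. *)
Lemma nA_star a : nA (star a) = nA a.
Proof.
suff h b : nA b <= nA (star b).
  by apply/le_anti; rewrite h -{2}(cs_star_invol HA a) h.
have [b0|bp] := leP (nA b) 0; first exact: le_trans b0 (nA_ge0 _).
by rewrite -(ler_pM2r bp) -expr2 -(cs_cstar_id HA) (cs_norm_submult HA).
Qed.
Lemma nA1 : nA 1 = 1.
Proof.
have h := cs_cstar_id HA 1; rewrite star1 mulr1 in h.
have n0 : nA 1 != 0.
  by apply/eqP => /(cs_norm_eq0 HA)/eqP; rewrite oner_eq0.
by apply: (mulfI n0); rewrite mulr1 -expr2.
Qed.
Lemma nA_scalar t : nA t%:S = `|t|.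
Proof. by rewrite nAZ nA1 mulr1. Qed.
Lemma nA_sqr a : star a = a -> nA (a * a) = nA a ^+ 2.
Proof. by move=> {1}<-; exact: cs_cstar_id HA a. Qed.

Lemma nA_small_eq0 a : (forall e, 0 < e -> nA a <= e) -> a = 0.
Proof.
move=> h; apply: (cs_norm_eq0 HA); apply/le_anti; rewrite nA_ge0 andbT.
by apply: le_of_lt_eps => e e0; rewrite add0r h.
Qed.

Lemma converges_unique u a b : converges_to nA u a -> converges_to nA u b -> a = b.
Proof.
move=> ha hb; apply/eqP; rewrite -subr_eq0; apply/eqP; apply: nA_small_eq0 => e e0.
have e2 : 0 < e / 2 by lra.
have [N hN] := ha _ e2; have [M hM] := hb _ e2.
have := hN _ (leq_maxl N M); have := hM _ (leq_maxr N M).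
set w := u _; have -> : a - b = (w - b) - (w - a) by rewrite opprB [RHS]addrC subrKA.
have := nAB (w - b) (w - a); lra.
Qed.

(** The root is [1 - l], where [l] is the fixed point of [y -> (x + y^2) / 2] reached by iteration
    from [0]. The ball of radius [c = |x| < 1] is preserved, and there the map contracts with ratio
    [c]. Self-adjointness and commutation pass from the iterates to the limit. *)
Lemma sqrt_one_sub x : star x = x -> nA x < 1 ->
  exists e, [/\ star e = e, e * e = 1 - x & forall z, x * z = z * x -> e * z = z * e].
Proof.
move=> sx x1; set c := nA x in x1.
have c0 : 0 <= c := nA_ge0 x.
pose h : A -> A := fun y => real_complex R (2^-1) *: (x + y * y).
pose y n := iter n h 0.
have yS n : y n.+1 = h (y n) by [].
have hle (a b : A) M : nA a <= M -> nA b <= M -> nA (h a - h b) <= M * nA (a - b).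
  move=> aM bM; rewrite /h -scalerBr opprD addrACA subrr add0r nAZ.
  have -> : a * a - b * b = a * (a - b) + (a - b) * b.
    by rewrite mulrBr mulrBl addrA subrK.
  have := nAD (a * (a - b)) ((a - b) * b).
  have := cs_norm_submult HA a (a - b); have := cs_norm_submult HA (a - b) b.
  have := nA_ge0 (a - b); set d := nA (a - b).
  have := nA_ge0 a; have := nA_ge0 b.
  rewrite ger0_norm ?invr_ge0//; set p := nA (_ + _); nra.
have yc n : nA (y n) <= c.
  elim: n => [|n ih]; first by rewrite /y /= nA0.
  rewrite yS /h nAZ ger0_norm ?invr_ge0//.
  have := nAD x (y n * y n); have := cs_norm_submult HA (y n) (y n).
  have := nA_ge0 (y n); rewrite -/c; set p := nA (_ + _); nra.
have cau : cauchy_seq nA y.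
  move=> e e0; have c01 : 0 <= c < 1 by rewrite c0.
  have e2 : 0 < e / 2 by lra.
  have [N hN] := exprn_lt c01 e2.
  have main : forall n m k, nA (y (n + m)%N - y (n + k)%N) <= 2 * c ^+ n.
    elim=> [|n ih] m k.
      rewrite !add0n expr0; have := nAB (y m) (y k); have := yc m; have := yc k; lra.
    rewrite !addSn !yS.
    apply: le_trans (hle _ _ c (yc _) (yc _)) _.
    rewrite exprS mulrCA; apply: ler_wpM2l => //.
  exists N => m n Nm Nn; rewrite -(subnKC Nm) -(subnKC Nn).
  apply: le_lt_trans (main _ _ _) _; lra.
have [l hl] := cs_complete HA cau.
(* Only continuity of [h] at [l] matters here, so any radius [M] bounding [l] and the iterates will
   do. *)
have lfix : h l = l.
  apply/eqP; rewrite -subr_eq0; apply/eqP; apply: nA_small_eq0 => e e0.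
  pose M := c + nA l; have lM : nA l <= M by rewrite lerDr.
  have d0 : 0 < e / (M + 1) by apply: divr_gt0 => //; have := nA_ge0 l; rewrite /M; lra.
  have [N hN] := hl _ d0.
  have h1 := hN N (leqnn _); have h2 := hN N.+1 (leqnSn _).
  have := nAD (h l - h (y N)) (y N.+1 - l); rewrite yS subrKA.
  have yM : nA (y N) <= M by apply: le_trans (yc _) _; rewrite lerDl nA_ge0.
  move=> h4; have h3 := hle l (y N) M lM yM; rewrite [nA (l - _)]nA_distC in h3.
  rewrite yS in h2.
  have M0 : 0 <= M by have := nA_ge0 l; rewrite /M; lra.
  have h5 : (M + 1) * (e / (M + 1)) = e by rewrite mulrC divfK// lt0r_neq0//; lra.
  have h6 : M * nA (y N - l) <= M * (e / (M + 1)) by apply: ler_wpM2l => //; exact: ltW.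
  rewrite mulrDl mul1r in h5; lra.
have ys n : star (y n) = y n.
  elim: n => [|n ih]; first exact: star0.
  by rewrite yS /h (cs_star_scale HA) conjc_real (cs_star_add HA)
             (cs_star_mul HA) ih sx.
have ls : star l = l.
  apply: (converges_unique _ hl) => e e0; have [N hN] := hl _ e0.
  by exists N => n Nn; rewrite -(ys n) -starB nA_star; exact: hN.
have lc z : x * z = z * x -> l * z = z * l.
  move=> xz.
  have yz n : y n * z = z * y n.
    elim: n => [|n ih]; first by rewrite /y /= mul0r mulr0.
    by rewrite yS /h -scalerAl -scalerAr mulrDl mulrDr xz -mulrA ih
               mulrA ih mulrA.
  apply/eqP; rewrite -subr_eq0; apply/eqP; apply: nA_small_eq0 => e e0.
  have d0 : 0 < e / (2 * nA z + 1) by apply: divr_gt0 => //; have := nA_ge0 z; lra.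
  have [N hN] := hl _ d0; have {}hN := hN N (leqnn _).
  have -> : l * z - z * l = z * (y N - l) - (y N - l) * z.
    by rewrite mulrBr mulrBl yz opprB [RHS]addrC subrKA.
  have := nAB (z * (y N - l)) ((y N - l) * z).
  have := cs_norm_submult HA z (y N - l); have := cs_norm_submult HA (y N - l) z.
  have : (2 * nA z + 1) * (e / (2 * nA z + 1)) = e.
    by rewrite mulrC divfK// lt0r_neq0//; have := nA_ge0 z; lra.
  have := nA_ge0 z; have := nA_ge0 (y N - l); move: hN; set q := e / _; nra.
have ll : l + l = x + l * l.
  rewrite -{1 2}lfix /h -scalerDl -rmorphD.
  have -> : 2^-1 + 2^-1 = 1 :> R by lra.
  by rewrite rmorph1 scale1r.
exists (1 - l); split.
- by rewrite starB star1 ls.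
- have -> : x = l + l - l * l by rewrite ll addrK.
  rewrite mulrBr !mulrBl mulr1 mul1r mulr1.
  by rewrite -[l + l - _]addrA [in RHS]opprD [RHS]addrA.
- by move=> z /lc h1; rewrite mulrBl mulrBr mul1r mulr1 h1.
Qed.

(* The root lies in the double commutant of [a], so that the roots occurring in
   one argument commute with each other. *)
Lemma sqrt_of_lt a t : star a = a -> nA (t%:S - a) < t ->
  exists e, [/\ star e = e, e * e = a & forall z, a * z = z * a -> e * z = z * e].
Proof.
move=> sa ht; have t0 : 0 < t := le_lt_trans (nA_ge0 _) ht.
(* With this scaling [1 - x = a / t], so the root of [1 - x] has to be multiplied by [sqrt t]. *)
pose x : A := real_complex R t^-1 *: (t%:S - a).
have sx : star x = x by rewrite (cs_star_scale HA) conjc_real starB star_scalar sa.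
have x1 : nA x < 1.
  by rewrite nAZ gtr0_norm ?invr_gt0// mulrC ltr_pdivrMr// mul1r.
have [e [se ee ec]] := sqrt_one_sub sx x1.
exists (real_complex R (Num.sqrt t) *: e); split.
- by rewrite (cs_star_scale HA) conjc_real se.
- rewrite -scalerAl -scalerAr scalerA -rmorphM -expr2 sqr_sqrtr ?ltW// ee.
  by rewrite /x scalerBr scalerA -rmorphM divff ?gt_eqF// rmorph1 scale1r subKr.
- move=> z az; rewrite -scalerAl -scalerAr ec// /x -scalerAl -scalerAr.
  by rewrite mulrBl mulrBr scalar_commutes az.
Qed.

(** For [w = a + i b], commutation gives [star w * w = a^2 + b^2], while [2 a = w + star w] gives
    [|a| <= |w|]. *)
Lemma nA_le_add_sqr a b : star a = a -> star b = b -> a * b = b * a ->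
  nA (a * a) <= nA (a * a + b * b).
Proof.
move=> sa sb ab; pose w : A := a + ('i)%C *: b.
have sw : star w = a - ('i)%C *: b.
  rewrite (cs_star_add HA) (cs_star_scale HA) sa sb.
  have -> : (('i)^*)%C = - ('i)%C :> R[i] by rewrite /=; simpc.
  by rewrite scaleNr.
have ww : star w * w = a * a + b * b.
  rewrite sw /w; set c := _ *: b.
  have ca : c * a = a * c by rewrite /c -scalerAl -scalerAr ab.
  have cc : c * c = - (b * b).
    rewrite /c -scalerAl -scalerAr scalerA.
    have -> : ('i * 'i)%C = -1 :> R[i] by rewrite /=; simpc.
    by rewrite scaleN1r.
  by rewrite mulrDr !mulrBl ca cc opprK addrA subrK.
have aw : a + a = w + star w by rewrite sw /w addrACA subrr addr0.
have nw := cs_cstar_id HA w; rewrite ww in nw; rewrite nw nA_sqr//.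
rewrite ler_pXn2r ?nnegrE ?nA_ge0//.
have := nAD w (star w); rewrite -aw nA_star -mulr2n -scaler_nat.
have -> : (2%:R : R[i]) = real_complex R 2 by rewrite rmorph_nat.
by rewrite nAZ ger0_norm//; lra.
Qed.

(* By the square root lemma this is spectral positivity; unlike [cstar_pos] it
   is visibly stable under sums. *)
Definition npos a := star a = a /\ exists t, nA (t%:S - a) <= t.

(** The shift by [d] makes the inequality [|t - a| <= t] strict, as [sqrt_of_lt] requires. *)
Lemma npos_sqrt a d : npos a -> 0 < d ->
  exists e, [/\ star e = e, e * e = a + d%:S & forall z, a * z = z * a -> e * z = z * e].
Proof.
move=> [sa [t ht]] d0.
have s1 : star (a + d%:S) = a + d%:S by rewrite (cs_star_add HA) sa star_scalar.
have h1 : nA ((t + d)%:S - (a + d%:S)) < t + d.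
  by rewrite scalarD [a + _]addrC addrKA; apply: le_lt_trans ht _; rewrite ltrDl.
have [e [se ee ec]] := sqrt_of_lt s1 h1.
by exists e; split=> // z az; apply: ec; rewrite mulrDl mulrDr az scalar_commutes.
Qed.

(** A root [e] of [t - b^2] commutes with [b], and [e^2 + b^2 = t], so [nA_le_add_sqr] bounds
    [|e^2|] by [t]. *)
Lemma nA_scalar_sub_sqr b t : star b = b -> nA (b * b) < t -> nA (t%:S - b * b) <= t.
Proof.
move=> sb bt; have t0 : 0 < t := le_lt_trans (nA_ge0 _) bt.
have s1 : star (t%:S - b * b) = t%:S - b * b.
  by rewrite starB star_scalar (cs_star_mul HA) sb.
have h1 : nA (t%:S - (t%:S - b * b)) < t by rewrite subKr.
have [e [se ee ec]] := sqrt_of_lt s1 h1.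
have eb : e * b = b * e.
  by apply: ec; rewrite mulrBl mulrBr scalar_commutes mulrA.
have := nA_le_add_sqr se sb eb; rewrite ee subrK nA_scalar ger0_norm//.
exact: ltW.
Qed.

Lemma npos_sqr b : star b = b -> npos (b * b).
Proof.
move=> sb; split; first by rewrite (cs_star_mul HA) sb.
by exists (nA (b * b) + 1); apply: nA_scalar_sub_sqr => //; rewrite ltrDl.
Qed.

Lemma nposD a b : npos a -> npos b -> npos (a + b).
Proof.
move=> [sa [t ht]] [sb [s hs]]; split; first by rewrite (cs_star_add HA) sa sb.
exists (t + s); rewrite scalarD opprD addrACA.
by apply: le_trans (nAD _ _) _; exact: lerD.
Qed.

Lemma npos_norm_sub a : star a = a -> npos ((nA a)%:S - a).
Proof.
by move=> sa; split; [rewrite starB star_scalar sa | exists (nA a); rewrite subKr].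
Qed.

(** Up to small shifts, [a] and [s - a] have commuting roots [e] and [f], and [e^2 + f^2] is a
    scalar close to [s] that dominates [|e^2|]. *)
Lemma nA_le_scalar a s : npos a -> npos (s%:S - a) -> nA a <= s.
Proof.
move=> pa pb; apply: le_of_lt_eps => d d0.
have d4 : 0 < d / 4 by lra.
have [e [se ee ec]] := npos_sqrt pa d4.
have [f [sf ff fc]] := npos_sqrt pb d4.
have ef : e * f = f * e.
  by apply: ec; rewrite fc// mulrBl mulrBr scalar_commutes.
have := nA_le_add_sqr se sf ef; rewrite ee ff.
have -> : a + (d / 4)%:S + (s%:S - a + (d / 4)%:S) = (s + d / 2)%:S.
  rewrite addrACA [a + (_ - _)]addrC subrK -!scalarD; congr (_%:S); lra.
(* The scalar [s] is the sum of [a] and [s - a]; being [npos], it satisfies [0 <= s]. *)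
have [_ [t]] := nposD pa pb; rewrite [a + _]addrC subrK -scalarB nA_scalar ler_norml => /andP[_ ts].
rewrite nA_scalar ger0_norm; last lra.
have := nAB (a + (d / 4)%:S) (d / 4)%:S; rewrite addrK nA_scalar (ger0_norm (ltW d4)).
lra.
Qed.

(** With [s = |a + b|], the element [s - a = (s - (a + b)) + b] is a sum of two [npos] elements. *)
Lemma nA_le_nposD a b : npos a -> npos b -> nA a <= nA (a + b).
Proof.
move=> pa pb; apply: nA_le_scalar => //.
have sab : star (a + b) = a + b by rewrite (cs_star_add HA) (proj1 pa) (proj1 pb).
have := nposD (npos_norm_sub sab) pb.
by rewrite opprD addrA subrK.
Qed.

Lemma star_inv a b : star a = a -> a * b = 1 -> b * a = 1 -> star b = b.
Proof.
move=> sa ab ba; have h : star b * a = 1 by rewrite -{1}sa -(cs_star_mul HA) ab star1.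
by rewrite -[RHS]mul1r -h -mulrA ab mulr1.
Qed.

(* If [a] were not [npos], then [b = t - a] with [t >= |a|] would have norm
   [beta > t], while [beta - b = a + (beta - t)] is [npos] and invertible, hence
   bounded below by some [d > 0]; so [|b| <= beta - d]. *)
Lemma cstar_pos_npos a : cstar_pos star a -> npos a.
Proof.
move=> [sa inva]; split=> //; pose t := nA a; exists t.
rewrite leNgt; apply/negP => tb; set beta := nA (t%:S - a) in tb.
pose b := t%:S - a.
have sb : star b = b by rewrite starB star_scalar sa.
have nb : nA b = beta by [].
have pb : npos b by split=> //; exists t; rewrite subKr.
pose p := beta%:S - b.
have pp : npos p by rewrite /p -nb; exact: npos_norm_sub.
(* For [d >= 0] the scalar subtracted from [a] is negative, so the spectral hypothesis makes [p + d]
   invertible. *)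
have pE d : p + d%:S = a - (real_complex R (- (beta - t + d)))%:A.
  have -> : p = a + (beta - t)%:S by rewrite /p /b opprB scalarB addrCA.
  by rewrite scalarN opprK (scalarD (beta - t)) addrA.
have inv d : 0 <= d -> invertible (p + d%:S).
  move=> d0; rewrite pE; apply: inva.
  by rewrite -(rmorph0 (real_complex R)) lecR -ltNge oppr_lt0; lra.
have [q [pq qp]] := inv 0 (lexx _); rewrite scalar0 addr0 in pq qp.
pose Q := nA q; have Q0 : 0 <= Q := nA_ge0 q.
(* Chosen so that [d Q < 1/8]: the inverse [m] of [p + d] then has norm at most [2 Q], and
   [|2 d m| < 1]. *)
pose d := (8 * (Q + 1))^-1.
have d0 : 0 < d by rewrite invr_gt0; lra.
have dQ : d * (8 * (Q + 1)) = 1 by rewrite mulVf// gt_eqF//; lra.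
have [m [em me]] := inv d (ltW d0).
have sp : star (p + d%:S) = p + d%:S by rewrite (cs_star_add HA) (proj1 pp) star_scalar.
have sm := star_inv sp em me.
(* By the resolvent identity [m = q - d q m]. *)
have mQ : nA m <= 2 * Q.
  have mE : m = q - real_complex R d *: (q * m).
    have h : q * ((p + d%:S) * m) = m + real_complex R d *: (q * m).
      by rewrite mulrDl mulrDr mulrA qp mul1r -scalerAl mul1r -scalerAr.
    by rewrite em mulr1 in h; exact: (canRL (addrK _) (esym h)).
  have := nAB q (real_complex R d *: (q * m)); rewrite -mE.
  rewrite nAZ gtr0_norm//; have := cs_norm_submult HA q m; rewrite -/Q.
  have := nA_ge0 m; nra.
pose x : A := real_complex R (2 * d) *: m.
have sx : star x = x by rewrite (cs_star_scale HA) conjc_real sm.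
have x1 : nA x < 1.
  rewrite nAZ gtr0_norm; last lra.
  nra.
have [f [sf ff fc]] := sqrt_one_sub sx x1.
have [e [se ee ec]] := npos_sqrt pp d0.
have ep : e * (p + d%:S) = (p + d%:S) * e by rewrite -ee mulrA.
have em' : m * e = e * m.
  by rewrite -[LHS]mulr1 -em mulrA -[m * e * _]mulrA ep mulrA me mul1r.
have fe : f * e = e * f by apply: fc; rewrite -scalerAl -scalerAr em'.
(* Here [e^2 = p + d] and [f^2 = 1 - 2 d m] with [m] inverse to [p + d], so the product is
   [p + d - 2 d]. *)
have gg : e * f * (e * f) = p - d%:S.
  rewrite mulrA -[e * f * e]mulrA fe mulrA ee -mulrA ff mulrBr mulr1.
  rewrite /x -scalerAr em -addrA; congr (_ + _).
  by rewrite -scalarB -scalarN; congr (_%:S); lra.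
have sg : star (e * f) = e * f by rewrite (cs_star_mul HA) se sf fe.
have := @nA_le_scalar b (beta - d) pb; rewrite nb scalarB addrAC -/p -gg.
move=> /(_ (npos_sqr sg)); lra.
Qed.

End CstarAlgebra.

(** * The quasi-norm of a Hilbert module *)

Section HilbertModule.
Variables (R : realType) (A : algType R[i]) (star : A -> A) (nA : A -> R).
Variables (E : lmodType R[i]) (act : E -> A -> E) (ip : E -> E -> A).
Hypotheses (HA : cstar_algebra star nA) (HE : hilbert_module star nA act ip).
Implicit Types (x y z v : E) (a b : A) (l : R[i]) (t : R).
Local Notation h := (hnorm nA ip).

Lemma ip0r x : ip x 0 = 0.
Proof. by rewrite -(scale0r 0) (hm_ip_scale HE) scale0r. Qed.
Lemma ipNr x y : ip x (- y) = - ip x y.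
Proof. by rewrite -scaleN1r (hm_ip_scale HE) scaleN1r. Qed.
Lemma ipBr x y z : ip x (y - z) = ip x y - ip x z.
Proof. by rewrite (hm_ip_add HE) ipNr. Qed.
Lemma ipDl x y z : ip (x + y) z = ip x z + ip y z.
Proof. by rewrite (hm_ip_sym HE) (hm_ip_add HE) (cs_star_add HA) -!(hm_ip_sym HE). Qed.
Lemma ipZl l x y : ip (l *: x) y = conjc l *: ip x y.
Proof.
by rewrite (hm_ip_sym HE) (hm_ip_scale HE) (cs_star_scale HA) -(hm_ip_sym HE).
Qed.
Lemma ipNl x y : ip (- x) y = - ip x y.
Proof. by rewrite (hm_ip_sym HE) ipNr (starN HA) -(hm_ip_sym HE). Qed.
Lemma ipBl x y z : ip (x - y) z = ip x z - ip y z.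
Proof. by rewrite ipDl ipNl. Qed.
Lemma ip0l x : ip 0 x = 0.
Proof. by rewrite (hm_ip_sym HE) ip0r (star0 HA). Qed.
Lemma ip_actl x y a : ip (act x a) y = star a * ip x y.
Proof. by rewrite (hm_ip_sym HE) (hm_ip_act HE) (cs_star_mul HA) -(hm_ip_sym HE). Qed.

Lemma ip_extr x y : (forall v, ip v x = ip v y) -> x = y.
Proof.
move=> hv; apply/eqP; rewrite -subr_eq0; apply/eqP; apply: (hm_ip_def HE).
by rewrite ipBr !hv subrr.
Qed.
Lemma ip_extl x y : (forall v, ip x v = ip y v) -> x = y.
Proof. by move=> hv; apply: ip_extr => v; rewrite 2!(hm_ip_sym HE _ v) hv. Qed.

Lemma actB x a b : act x (a - b) = act x a - act x b.
Proof. by apply: ip_extr => v; rewrite ipBr !(hm_ip_act HE) mulrBr. Qed.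

Lemma hnorm_ge0 x : 0 <= h x. Proof. exact: sqrtr_ge0. Qed.
Lemma hnorm_sqr x : h x ^+ 2 = nA (ip x x).
Proof. by rewrite sqr_sqrtr // (nA_ge0 HA). Qed.
Lemma hnorm_eq0 x : h x = 0 -> x = 0.
Proof.
move=> h0; apply: (hm_ip_def HE); apply: (cs_norm_eq0 HA).
by rewrite -hnorm_sqr h0 expr0n.
Qed.
Lemma hnorm0 : h 0 = 0.
Proof. by rewrite /hnorm ip0l (nA0 HA) sqrtr0. Qed.
Lemma hnorm_gt0 x : x <> 0 -> 0 < h x.
Proof. by move=> x0; rewrite lt_def hnorm_ge0 andbT; apply/eqP => /hnorm_eq0. Qed.

Lemma hnormZ l x : h (l *: x) = Normc.normc l * h x.
Proof.
rewrite /hnorm (hm_ip_scale HE) ipZl !(cs_norm_scale HA) normc_conj mulrA -expr2.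
by rewrite sqrtrM ?sqr_ge0// sqrtr_sqr ger0_norm ?normc_ge0.
Qed.
Lemma hnormZr t x : h (real_complex R t *: x) = `|t| * h x.
Proof. by rewrite hnormZ normc_real. Qed.
Lemma hnormN x : h (- x) = h x.
Proof. by rewrite /hnorm ipNl ipNr opprK. Qed.
Lemma hnorm_distC x y : h (x - y) = h (y - x).
Proof. by rewrite -hnormN opprB. Qed.

Lemma npos_ip x : npos star nA (ip x x).
Proof. exact: (cstar_pos_npos HA) (hm_ip_pos HE x). Qed.

(* The parallelogram law needs only monotonicity of the norm on positive
   elements; the resulting quasi-triangle inequality is all that is used. *)
Lemma hnorm_sqrD x y : h (x + y) ^+ 2 <= 2 * h x ^+ 2 + 2 * h y ^+ 2.
Proof.
rewrite !hnorm_sqr.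
apply: le_trans (nA_le_nposD HA (npos_ip (x + y)) (npos_ip (x - y))) _.
have -> : ip (x + y) (x + y) + ip (x - y) (x - y) = (ip x x + ip x x) + (ip y y + ip y y).
  rewrite ipDl ipBl !ipBr !(hm_ip_add HE) opprB addrACA [ip y x + _]addrC.
  by rewrite [X in X + _]addrACA [X in _ + X]addrACA !subrr !addr0.
have := nAD HA (ip x x + ip x x) (ip y y + ip y y).
have := nAD HA (ip x x) (ip x x); have := nAD HA (ip y y) (ip y y); lra.
Qed.

Lemma hnormD x y : h (x + y) <= 2 * (h x + h y).
Proof.
have := hnorm_sqrD x y; have := hnorm_ge0 x; have := hnorm_ge0 y.
have := hnorm_ge0 (x + y); nra.
Qed.
Lemma hnormB x y : h (x - y) <= 2 * (h x + h y).
Proof. by rewrite -(hnormN y); exact: hnormD. Qed.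

(** Polarisation: the sum is [ip (x + y) (x + y) - ip x x - ip y y]. *)
Lemma nA_ip_add_sym x y : nA (ip x y + ip y x) <= 3 * (h x ^+ 2 + h y ^+ 2).
Proof.
have -> : ip x y + ip y x = ip (x + y) (x + y) - (ip x x + ip y y).
  by rewrite ipDl !(hm_ip_add HE) [ip x x + ip x y]addrC addrACA addrK.
have := nAB HA (ip (x + y) (x + y)) (ip x x + ip y y).
have := nAD HA (ip x x) (ip y y).
have := hnorm_sqrD x y; rewrite !hnorm_sqr; lra.
Qed.

(** Replacing [x] by [i x] in the symmetric bound controls [ip x y - ip y x]; adding the two bounds
    isolates [2 ip x y]. *)
Lemma nA_ip_le_sqr x y : nA (ip x y) <= 3 * (h x ^+ 2 + h y ^+ 2).
Proof.
have h1 := nA_ip_add_sym x y.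
have := nA_ip_add_sym (('i)%C *: x) y.
rewrite ipZl (hm_ip_scale HE) hnormZ normc_i mul1r => h2.
have e2 : nA (conjc 'i%C *: ip x y + 'i%C *: ip y x) = nA (ip x y - ip y x).
  have -> : conjc 'i%C *: ip x y + 'i%C *: ip y x = (- 'i)%C *: (ip x y - ip y x).
    rewrite scalerBr !scaleNr opprK; congr (_ + _).
    by rewrite -scaleNr; congr (_ *: _); rewrite /=; simpc.
  rewrite (cs_norm_scale HA).
  have -> : Normc.normc (- 'i : R[i])%C = 1.
    by rewrite /Normc.normc /= oppr0 expr0n add0r sqrrN expr1n sqrtr1.
  by rewrite mul1r.
rewrite e2 in h2.
have := nAD HA (ip x y + ip y x) (ip x y - ip y x).
have -> : ip x y + ip y x + (ip x y - ip y x) = ip x y + ip x y.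
  by rewrite addrACA subrr addr0.
rewrite -mulr2n -scaler_nat.
have -> : (2%:R : R[i]) = real_complex R 2 by rewrite rmorph_nat.
rewrite (nAZ HA) ger0_norm//; lra.
Qed.

(* Cauchy-Schwarz up to a constant, by normalising both arguments. *)
Lemma nA_ip_le x y : nA (ip x y) <= 6 * h x * h y.
Proof.
have [->|x0] := pselect (x = 0).
  by rewrite ip0l (nA0 HA) !mulr_ge0 ?hnorm_ge0.
have [->|y0] := pselect (y = 0).
  by rewrite ip0r (nA0 HA) !mulr_ge0 ?hnorm_ge0.
have hx := hnorm_gt0 x0; have hy := hnorm_gt0 y0.
have := nA_ip_le_sqr (real_complex R (h x)^-1 *: x) (real_complex R (h y)^-1 *: y).
rewrite !hnormZr !gtr0_norm ?invr_gt0// !mulVf ?gt_eqF// expr1n.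
rewrite ipZl conjc_real (hm_ip_scale HE) !(nAZ HA) !gtr0_norm ?invr_gt0//.
rewrite mulrA -invfM mulrC ler_pdivrMr ?mulr_gt0//; lra.
Qed.

Lemma hnorm_act x a : h (act x a) <= nA a * h x.
Proof.
rewrite -(ler_pXn2r (ltn0Sn 1)) ?nnegrE ?mulr_ge0 ?hnorm_ge0 ?(nA_ge0 HA)//.
rewrite hnorm_sqr (hm_ip_act HE) ip_actl exprMn hnorm_sqr.
apply: le_trans (cs_norm_submult HA _ _) _.
have := cs_norm_submult HA (star a) (ip x x); rewrite (nA_star HA).
have := nA_ge0 HA a; nra.
Qed.

End HilbertModule.

(** * Compact operators *)

Section CompactOperators.
Variables (R : realType) (A : algType R[i]) (star : A -> A) (nA : A -> R).
Variables (E : lmodType R[i]) (act : E -> A -> E) (ip : E -> E -> A).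
Hypotheses (HA : cstar_algebra star nA) (HE : hilbert_module star nA act ip).
Implicit Types (x y z v : E) (a b : A) (l : R[i]) (t : R) (T F S K : E -> E).
Local Notation h := (hnorm nA ip).
Local Notation h_ge0 := (hnorm_ge0 nA ip).
Local Notation hD := (hnormD HA HE).
Local Notation hB := (hnormB HA HE).
Local Notation compact := (compact_op nA act ip).
Local Notation frank := (finite_rank act ip).

Lemma adjointableB T x y : adjointable ip T -> T (x - y) = T x - T y.
Proof.
by move=> [T' hT]; apply: (ip_extl HE) => v; rewrite hT !(ipBl HA HE) !hT.
Qed.
Lemma adjointableZ T l x : adjointable ip T -> T (l *: x) = l *: T x.
Proof.
by move=> [T' hT]; apply: (ip_extl HE) => v; rewrite hT !(ipZl HA HE) hT.
Qed.
Lemma adjointable0 T : adjointable ip T -> T 0 = 0.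
Proof. by move=> aT; have := adjointableB 0 0 aT; rewrite !subrr. Qed.
Lemma adjointableD T x y : adjointable ip T -> T (x + y) = T x + T y.
Proof.
move=> aT; rewrite -{1}(opprK y) adjointableB// -(sub0r y) adjointableB//.
by rewrite adjointable0// sub0r opprK.
Qed.
Lemma adjointable_sum T n (u : 'I_n -> E) : adjointable ip T ->
  T (\sum_(i < n) u i) = \sum_(i < n) T (u i).
Proof.
by move=> aT; apply: (big_morph T (fun x y => adjointableD x y aT) (adjointable0 aT)).
Qed.
Lemma adjointable_act T x a : adjointable ip T -> T (act x a) = act (T x) a.
Proof.
by move=> [T' hT]; apply: (ip_extl HE) => v; rewrite hT !(ip_actl HA HE) hT.
Qed.

(** Kept apart from [adjointable], whose definition contains no bound. *)
Definition bounded_op T := exists M : R, 0 <= M /\ forall z, h (T z) <= M * h z.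

Lemma finite_rank0 : frank (fun _ => 0).
Proof. by exists 0%N, (fun _ => 0), (fun _ => 0), (fun _ => 0) => z; rewrite big_ord0. Qed.

Lemma finite_rank_add_theta F x y : frank F -> frank (fun z => F z + theta act ip x y z).
Proof.
move=> [n [l [xs [ys hF]]]].
exists n.+1, (fun i => if unlift ord0 i is Some j then l j else 1),
  (fun i => if unlift ord0 i is Some j then xs j else x),
  (fun i => if unlift ord0 i is Some j then ys j else y) => z.
rewrite big_ord_recl unlift_none scale1r addrC hF; congr (_ + _).
by apply: eq_bigr => i _; rewrite liftK.
Qed.

(** Scalars are absorbed into the first vectors, so a property of finite rank operators reduces to
    adding a single [theta]. *)
Lemma finite_rank_ind (Pr : (E -> E) -> Prop) :
  Pr (fun _ => 0) -> (forall F x y, frank F -> Pr F -> Pr (fun z => F z + theta act ip x y z)) ->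
  forall F, frank F -> Pr F.
Proof.
move=> P0 PS F [n [l [xs [ys hF]]]].
have -> : F = fun z => \sum_(i < n) theta act ip (l i *: xs i) (ys i) z.
  apply: funext => z; rewrite hF; apply: eq_bigr => i _.
  by rewrite /theta (hm_act_scalel HE).
suff gen m (us vs : 'I_m -> E) : Pr (fun z => \sum_(i < m) theta act ip (us i) (vs i) z).
  exact: gen (fun i => l i *: xs i) ys.
elim: m us vs => {n l xs ys F hF} [|n ih] xs ys.
  by under eq_fun do rewrite big_ord0.
under eq_fun do rewrite big_ord_recr /=.
pose w i := widen_ord (leqnSn n) i.
apply: (PS (fun z => \sum_(i < n) theta act ip (xs (w i)) (ys (w i)) z)); last first.
  exact: (ih (fun i => xs (w i)) (fun i => ys (w i))).
exists n, (fun=> 1), (fun i => xs (w i)), (fun i => ys (w i)) => z.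
by under [RHS]eq_bigr do rewrite scale1r.
Qed.

Lemma finite_rankD F G : frank F -> frank G -> frank (fun z => F z + G z).
Proof.
move=> hF; elim/finite_rank_ind => [|{}G x y _ ih].
  by under eq_fun do rewrite addr0.
by under eq_fun do rewrite addrA; exact: finite_rank_add_theta.
Qed.

Lemma finite_rankN F : frank F -> frank (fun z => - F z).
Proof.
elim/finite_rank_ind => [|{}F x y _ ih].
  by under eq_fun do rewrite oppr0; exact: finite_rank0.
have -> : (fun z => - (F z + theta act ip x y z)) = (fun z => - F z + theta act ip (- x) y z).
  apply: funext => z; rewrite opprD; congr (_ + _).
  by rewrite /theta -[in RHS]scaleN1r -(hm_act_scalel HE) scaleN1r.
exact: finite_rank_add_theta.
Qed.

(** Moving [S] across the inner product turns [theta x y] composed with [S] into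
    [theta x (S' y)]. *)
Lemma finite_rank_comp F S : frank F -> adjointable ip S -> frank (fun z => F (S z)).
Proof.
move=> hF [S' hS]; elim/finite_rank_ind : F / hF => [|F x y _ ih]; first exact: finite_rank0.
have -> : (fun z => F (S z) + theta act ip x y (S z)) =
          (fun z => F (S z) + theta act ip x (S' y) z).
  apply: funext => z; rewrite /theta (hm_ip_sym HE (S z)) hS.
  by rewrite (hm_ip_sym HE (S' y)) (cs_star_invol HA).
exact: finite_rank_add_theta.
Qed.

Lemma finite_rank_adjoint F : frank F ->
  exists F', frank F' /\ forall x y, ip (F x) y = ip x (F' y).
Proof.
elim/finite_rank_ind => [|{}F x y _ [F' [fF hF]]].
  exists (fun _ => 0); split; first exact: finite_rank0.
  by move=> x y; rewrite (ip0l HA HE) (ip0r HE).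
exists (fun z => F' z + theta act ip y x z); split; first exact: finite_rank_add_theta.
move=> u v; rewrite (ipDl HA HE) (hm_ip_add HE) hF; congr (_ + _).
by rewrite (ip_actl HA HE) (hm_ip_act HE) -(hm_ip_sym HE).
Qed.

Lemma finite_rank_bounded F : frank F -> bounded_op F.
Proof.
elim/finite_rank_ind => [|{}F x y _ [M [M0 hM]]].
  by exists 0; split=> // z; rewrite (hnorm0 HA HE) mul0r.
exists (2 * (M + 6 * h y * h x)); split.
  by have := h_ge0 x; have := h_ge0 y; nra.
move=> z /=. apply: le_trans (hD _ _) _.
have := hM z; have := hnorm_act HA HE x (ip y z); have := nA_ip_le HA HE y z.
rewrite -/(theta act ip x y z); have := h_ge0 x; set p := nA _ => px p1 p2 p3.
have : p * h x <= 6 * h y * h z * h x by rewrite ler_wpM2r.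
lra.
Qed.

Lemma compact_adjointable T : compact T -> adjointable ip T. Proof. by case. Qed.

Lemma compact_bounded T : compact T -> bounded_op T.
Proof.
move=> [_ /(_ 1 ltr01)[F [/finite_rank_bounded[M [M0 hM]] hF]]].
exists (2 * (1 + M)); split; first lra.
move=> z; rewrite -(subrK (F z) (T z)); apply: le_trans (hD _ _) _.
have := hF z; have := hM z; lra.
Qed.

Lemma finite_rank_compact F : frank F -> compact F.
Proof.
move=> hF; split.
  by have [F' [_ hF']] := finite_rank_adjoint hF; exists F'.
move=> e e0; exists F; split=> // z.
by rewrite subrr (hnorm0 HA HE) mulr_ge0 ?h_ge0 ?ltW.
Qed.

Lemma adjointable_add T S : adjointable ip T -> adjointable ip S ->
  adjointable ip (fun z => T z + S z).
Proof.
move=> [T' hT] [S' hS]; exists (fun z => T' z + S' z) => x y.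
by rewrite (ipDl HA HE) (hm_ip_add HE) hT hS.
Qed.
Lemma adjointable_comp T S : adjointable ip T -> adjointable ip S ->
  adjointable ip (fun z => T (S z)).
Proof. by move=> [T' hT] [S' hS]; exists (fun z => S' (T' z)) => x y; rewrite hT hS. Qed.

Lemma compactD T S : compact T -> compact S -> compact (fun z => T z + S z).
Proof.
move=> [aT hT] [aS hS]; split; first exact: adjointable_add.
move=> e e0; have e4 : 0 < e / 4 by lra.
have [F [fF hF]] := hT _ e4; have [G [fG hG]] := hS _ e4.
exists (fun z => F z + G z); split; first exact: finite_rankD.
move=> z /=; rewrite opprD addrACA; apply: le_trans (hD _ _) _.
have := hF z; have := hG z; lra.
Qed.

Lemma compact_comp T S : compact T -> adjointable ip S -> bounded_op S ->
  compact (fun z => T (S z)).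
Proof.
move=> [aT hT] aS [M [M0 hM]]; split; first exact: adjointable_comp.
move=> e e0; have d0 : 0 < e / (M + 1) by apply: divr_gt0 => //; lra.
have [F [fF hF]] := hT _ d0; exists (fun z => F (S z)); split; first exact: finite_rank_comp.
move=> z /=; apply: le_trans (hF _) _.
have h1 : e / (M + 1) * (M + 1) = e by rewrite divfK// gt_eqF//; lra.
have h2 : e / (M + 1) * h (S z) <= e / (M + 1) * (M * h z) by rewrite ler_wpM2l// ltW.
apply: le_trans h2 _; rewrite mulrA ler_wpM2r ?h_ge0//; nra.
Qed.

(** If [F] approximates [T], its adjoint [F'] approximates [T']: for [w = T' z - F' z], [|w|^2] is
    the norm of [ip (T w - F w) z]. The choice [e / 6] absorbs the Cauchy-Schwarz constant. *)
Lemma compact_adjoint T T' : compact T -> (forall x y, ip (T x) y = ip x (T' y)) -> compact T'.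
Proof.
move=> [_ hT] adj.
have adj' x y : ip (T' x) y = ip x (T y).
  by rewrite (hm_ip_sym HE) -adj -(hm_ip_sym HE).
split; first by exists T.
move=> e e0; have e6 : 0 < e / 6 by lra.
have [F [fF hF]] := hT _ e6; have [F' [fF' hF']] := finite_rank_adjoint fF.
exists F'; split=> // z; set w := T' z - F' z.
have [->|/eqP w0] := eqVneq w 0; first by rewrite (hnorm0 HA HE) mulr_ge0 ?h_ge0 ?ltW.
have wp := hnorm_gt0 HA HE w0.
rewrite -(ler_pM2r wp) -expr2 (hnorm_sqr ip HA).
have -> : ip w w = ip (T w - F w) z.
  by rewrite {2}/w (ipBr HE) (ipBl HA HE) -adj -hF'.
apply: le_trans (nA_ip_le HA HE _ _) _.
have := hF w; have := h_ge0 z; set p := h (_ - _); nra.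
Qed.

(** * Norm convergence and the effect of compact operators on weak convergence *)

Section Convergence.
Implicit Types (u w : nat -> E).
Local Notation cvg := (converges_to h).

Lemma cvgD u w x y : cvg u x -> cvg w y -> cvg (fun n => u n + w n) (x + y).
Proof.
move=> hu hw e e0; have e4 : 0 < e / 4 by lra.
have [N hN] := hu _ e4; have [M hM] := hw _ e4.
exists (maxn N M) => n; rewrite geq_max => /andP[/hN h1 /hM h2].
rewrite opprD addrACA; apply: le_lt_trans (hD _ _) _; lra.
Qed.

Lemma cvg_unique u x y : cvg u x -> cvg u y -> x = y.
Proof.
move=> hu hw; apply/eqP; rewrite -subr_eq0; apply/eqP; apply: (hnorm_eq0 HA HE).
apply/le_anti; rewrite h_ge0 andbT; apply: le_of_lt_eps => e e0.
have e4 : 0 < e / 4 by lra.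
have [N hN] := hu _ e4; have [M hM] := hw _ e4.
have := hN _ (leq_maxl N M); have := hM _ (leq_maxr N M); set n := maxn _ _.
have -> : x - y = (u n - y) - (u n - x) by rewrite opprB [RHS]addrC subrKA.
have := hB (u n - y) (u n - x); lra.
Qed.

Lemma cvg_image T u x : adjointable ip T -> bounded_op T -> cvg u x ->
  cvg (fun n => T (u n)) (T x).
Proof.
move=> aT [M [M0 hM]] hu e e0.
have d0 : 0 < e / (M + 1) by apply: divr_gt0 => //; lra.
have [N hN] := hu _ d0; exists N => n /hN h1.
rewrite -adjointableB//; apply: le_lt_trans (hM _) _.
have h2 : e / (M + 1) * (M + 1) = e by rewrite divfK// gt_eqF//; lra.
have := h_ge0 (u n - x); nra.
Qed.

Lemma cvg_norm_bounded u x : cvg u x -> exists N M, forall n, (N <= n)%N -> h (u n) <= M.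
Proof.
move=> /(_ 1 ltr01)[N hN]; exists N, (2 * (1 + h x)) => n /hN h1.
by rewrite -(subrK x (u n)); apply: le_trans (hD _ _) _; lra.
Qed.

Lemma le_subseq (phi : nat -> nat) : (forall k, (phi k < phi k.+1)%N) -> forall n, (n <= phi n)%N.
Proof. by move=> hp; elim=> // n ih; apply: leq_ltn_trans ih (hp n). Qed.

Lemma cvg_subseq u x (phi : nat -> nat) : (forall k, (phi k < phi k.+1)%N) ->
  cvg u x -> cvg (fun n => u (phi n)) x.
Proof.
move=> hp hu e /hu[N hN]; exists N => n Nn; apply: hN.
exact: leq_trans Nn (le_subseq hp n).
Qed.

Lemma cvg_inv_nat u : (forall n, h (u n) <= n.+1%:R^-1) -> cvg u 0.
Proof.
move=> hu e /inv_nat_lt[N hN]; exists N => n /hN h1.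
by rewrite subr0; apply: le_lt_trans (hu _) h1.
Qed.

(** For one [theta x y] the image is [act x (ip y (u k))], and its coefficient converges in the norm
    of the algebra. *)
Lemma finite_rank_weak_cvg F u z : frank F ->
  (forall v, converges_to nA (fun k => ip v (u k)) (ip v z)) -> cvg (fun k => F (u k)) (F z).
Proof.
move=> hF hu; elim/finite_rank_ind : F / hF => [|F x y _ ih].
  by move=> e e0; exists 0%N => n _; rewrite subrr (hnorm0 HA HE).
apply: cvgD ih _ => e e0; have d0 : 0 < e / (h x + 1).
  by apply: divr_gt0 => //; have := h_ge0 x; lra.
have [N hN] := hu y _ d0; exists N => n /hN h1.
rewrite /theta -(actB HE); apply: le_lt_trans (hnorm_act HA HE _ _) _.
have h2 : e / (h x + 1) * (h x + 1) = e by rewrite divfK// gt_eqF//; have := h_ge0 x; lra.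
have := nA_ge0 HA (ip y (u n) - ip y z); have := h_ge0 x; nra.
Qed.

Lemma compact_weak_cvg T u z M : compact T -> (forall n, h (u n) <= M) ->
  (forall v, converges_to nA (fun k => ip v (u k)) (ip v z)) -> cvg (fun k => T (u k)) (T z).
Proof.
move=> [_ hT] hM hu e e0.
have M0 : 0 <= M := le_trans (h_ge0 _) (hM 0%N).
(* The factor 8 pays for two nested quasi-triangle inequalities, each costing a factor 2. *)
have B0 : 0 < 8 * (M + h z + 1) by have := h_ge0 z; lra.
have [F [fF hF]] := hT _ (divr_gt0 e0 B0); set d := e / _ in hF.
have dB : d * (8 * (M + h z + 1)) = e by rewrite divfK// gt_eqF.
have e8 : 0 < e / 8 by lra.
have [N hN] := finite_rank_weak_cvg fF hu e8; exists N => n /hN h1.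
have -> : T (u n) - T z = (T (u n) - F (u n)) + ((F (u n) - F z) - (T z - F z)).
  by rewrite opprB !subrKA.
apply: le_lt_trans (hD _ _) _.
have := hB (F (u n) - F z) (T z - F z).
have := hF (u n); have := hF z; have := hM n; have := h_ge0 z.
have d0 : 0 < d by exact: divr_gt0.
nra.
Qed.

End Convergence.
End CompactOperators.

(** * Riesz theory under property [H] *)

Section RieszTheory.
Variables (R : realType) (A : algType R[i]) (star : A -> A) (nA : A -> R).
Variables (E : lmodType R[i]) (act : E -> A -> E) (ip : E -> E -> A).
Hypotheses (HA : cstar_algebra star nA) (HE : hilbert_module star nA act ip).
Hypothesis HH : property_H nA ip.
Implicit Types (x y z v : E) (t : R) (T K : E -> E).
Local Notation h := (hnorm nA ip).
Local Notation h_ge0 := (hnorm_ge0 nA ip).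
Local Notation cvg := (converges_to h).
Local Notation compact := (compact_op nA act ip).
Local Notation adjointable := (adjointable ip).
Local Notation bounded_op := (bounded_op nA ip).

Lemma compact_seq K (u : nat -> E) M : compact K -> (forall n, h (u n) <= M) ->
  exists (phi : nat -> nat) z, (forall k, (phi k < phi k.+1)%N) /\
    (forall v, converges_to nA (fun k => ip v (u (phi k))) (ip v z)) /\
    cvg (fun k => K (u (phi k))) (K z).
Proof.
move=> cK hM; have [|phi [z [hp hz]]] := HH (zeta := u); first by exists M.
exists phi, z; split=> //; split=> //.
exact: (compact_weak_cvg HA HE cK (fun n => hM (phi n)) hz).
Qed.

(** Riesz's lemma for a quasi-norm: an approximation [m] of [x] that is optimal up to a factor 2 is
    subtracted and the difference normalised. The distance 1/2 to [S] survives because [S] is stable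
    under real combinations. *)
Lemma riesz_lemma (S : E -> Prop) x : S 0 ->
  (forall t y z, S y -> S z -> S (y + real_complex R t *: z)) ->
  (forall u y, (forall n, S (u n)) -> cvg u y -> S y) -> ~ S x ->
  exists m t, [/\ S m, h (real_complex R t *: (x - m)) = 1 &
    forall m', S m' -> 1 <= 2 * h (real_complex R t *: (x - m) - m')].
Proof.
move=> S0 Slin Scl nSx.
have [d [d0 hd]] : exists d, 0 < d /\ forall m, S m -> d <= h (x - m).
  apply: contrapT => hn.
  have /choice[u hu] : forall n : nat, exists m, S m /\ h (x - m) <= n.+1%:R^-1.
    move=> n; apply: contrapT => hm; apply: hn; exists n.+1%:R^-1; split.
      by rewrite invr_gt0.
    move=> m Sm; rewrite leNgt; apply/negP => /ltW hlt.
    by apply: hm; exists m.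
  apply: nSx; apply: (Scl u) => [n|e /inv_nat_lt[N hN]]; first by have [] := hu n.
  exists N => n /hN; rewrite (hnorm_distC HA HE).
  by apply: le_lt_trans; have [] := hu n.
(* Otherwise the distance to [x] could be halved for ever, starting from [0] in [S], and would drop
   below [d]. *)
have [m [Sm hm]] : exists m, S m /\ forall m', S m' -> h (x - m) <= 2 * h (x - m').
  apply: contrapT => hn.
  have hlv (n : nat) : exists m, S m /\ h (x - m) <= 2^-1 ^+ n * h x.
    elim: n => [|n [m [Sm hm]]].
      by exists 0; rewrite subr0 expr0 mul1r.
    apply: contrapT => hm'; apply: hn; exists m; split=> // m' Sm'.
    rewrite leNgt; apply/negP => hlt; apply: hm'; exists m'; split=> //.
    rewrite exprS; lra.
  have [hx0|hx0] := leP (h x) 0.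
    by have := hd _ S0; rewrite subr0; lra.
  have half : 0 <= (2^-1 : R) < 1 by apply/andP; split; lra.
  have [N hN] := exprn_lt half (divr_gt0 d0 hx0).
  have [m [/hd h1 h2]] := hlv N; move: hN; rewrite ltr_pdivlMr//; lra.
have dm := lt_le_trans d0 (hd _ Sm).
exists m, (h (x - m))^-1; split=> //.
  by rewrite (hnormZr HA HE) gtr0_norm ?invr_gt0// mulVf// gt_eqF.
move=> m' Sm'.
have -> : real_complex R (h (x - m))^-1 *: (x - m) - m' =
    real_complex R (h (x - m))^-1 *: (x - (m + real_complex R (h (x - m)) *: m')).
  rewrite opprD addrA [RHS]scalerBr scalerA -rmorphM mulVf ?gt_eqF//.
  by rewrite rmorph1 scale1r.
rewrite (hnormZr HA HE) gtr0_norm ?invr_gt0//.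
have := hm _ (Slin (h (x - m)) _ _ Sm Sm').
by move=> hle; rewrite mulrCA mulrC ler_pdivlMr// mul1r.
Qed.

Lemma adjointable_IminusC K : adjointable K -> adjointable (IminusC K).
Proof.
move=> [K' hK]; exists (IminusC K') => x y.
by rewrite /IminusC (ipBl HA HE) (ipBr HE) hK.
Qed.

Lemma bounded_IminusC K : bounded_op K -> bounded_op (IminusC K).
Proof.
move=> [M [M0 hM]]; exists (2 * (1 + M)); split; first lra.
move=> z; apply: le_trans (hnormB HA HE _ _) _; have := hM z; lra.
Qed.

(** If no [c] worked, there would be unit vectors [u n] at distance at least 1/2 from the kernel
    with [T (u n)] tending to 0. As [u n = T (u n) + K (u n)], a subsequence converges to a kernel
    element, a contradiction. *)
Lemma IminusC_lower_bound K : compact K -> exists c, 0 <= c /\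
  forall x, exists k, IminusC K k = 0 /\ h (x - k) <= c * h (IminusC K x).
Proof.
move=> cK; set T := IminusC K.
have aT : adjointable T by apply: adjointable_IminusC; case: cK.
have bT : bounded_op T := bounded_IminusC (compact_bounded HA HE cK).
apply: contrapT => hn.
have /choice[u hu] : forall n : nat, exists u,
    [/\ h u = 1, n.+1%:R * h (T u) <= 1 & forall k, T k = 0 -> 1 <= 2 * h (u - k)].
  move=> n; apply: contrapT => hu; apply: hn; exists n.+1%:R; split=> // x.
  apply: contrapT => hx.
  have nx : ~ T x = 0.
    move=> Tx; apply: hx; exists x; split=> //.
    by rewrite subrr Tx (hnorm0 HA HE) mulr0.
  have [|t y z Ty Tz|w y Tw hw|m [t [Tm h1 h2]]] := @riesz_lemma (fun k => T k = 0) x _ _ _ nx.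
  - exact (adjointable0 HA HE aT).
  - by rewrite (adjointableD HA HE) // (adjointableZ HA HE) // Ty Tz scaler0 addr0.
  - apply: (cvg_unique HA HE (u := fun n => T (w n))).
      exact: (cvg_image HA HE aT bT hw).
    by move=> e e0; exists 0%N => j _; rewrite Tw subrr (hnorm0 HA HE).
  apply: hu; exists (real_complex R t *: (x - m)); split=> //.
  rewrite -[leRHS]h1 (adjointableZ HA HE _ _ aT) (adjointableB HA HE _ _ aT) Tm subr0.
  rewrite !(hnormZr HA HE) mulrCA; apply: ler_wpM2l => //.
  rewrite leNgt; apply/negP => hlt; apply: hx; exists m; split=> //.
  exact: ltW.
have hu1 n : h (u n) <= 1 by have [-> _ _] := hu n.
have [phi [z [hp [_ hz]]]] := compact_seq cK hu1.
have Tu0 : cvg (fun n => T (u n)) 0.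
  apply: cvg_inv_nat => n; have [_ + _] := hu n.
  by rewrite mulrC -ler_pdivlMr// mul1r.
have uz : cvg (fun n => u (phi n)) (K z).
  have := cvgD HA HE (cvg_subseq hp Tu0) hz; rewrite add0r.
  by under eq_fun do rewrite /T /IminusC subrK.
have Tz : T (K z) = 0.
  apply: (cvg_unique HA HE (u := fun n => T (u (phi n)))); last exact: (cvg_subseq hp Tu0).
  exact: (cvg_image HA HE aT bT uz).
have h2 : 0 < 2^-1 :> R by lra.
have [N hN] := uz _ h2; have := hN N (leqnn _); have [_ _ /(_ _ Tz)] := hu (phi N); lra.
Qed.

(** Subtracting kernel elements makes the preimages bounded without changing their images; then
    [w = T w + K w] converges along a subsequence. *)
Lemma IminusC_closed_range K (u : nat -> E) y : compact K ->
  cvg (fun n => IminusC K (u n)) y -> exists x, y = IminusC K x.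
Proof.
move=> cK; set T := IminusC K => hy.
have aT : adjointable T by apply: adjointable_IminusC; case: cK.
have bT : bounded_op T := bounded_IminusC (compact_bounded HA HE cK).
have [c [c0 hc]] := IminusC_lower_bound cK; rewrite -/T in hc.
have [N [M hM]] := cvg_norm_bounded HA HE hy.
have /choice[k hk] : forall n, exists k, T k = 0 /\ h (u n - k) <= c * h (T (u n)).
  by move=> n; exact: hc.
(* The bound on the images holds only from [N] on, hence the shift. *)
pose w n := u (n + N)%N - k (n + N)%N.
have Tw n : T (w n) = T (u (n + N)%N).
  by rewrite (adjointableB HA HE)// (proj1 (hk _)) subr0.
have wM n : h (w n) <= c * M.
  apply: le_trans (proj2 (hk _)) _; apply: ler_wpM2l => //.
  by apply: hM; rewrite leq_addl.
have [phi [z [hp [_ hz]]]] := compact_seq cK wM.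
have Twy : cvg (fun n => T (w n)) y.
  move=> e /hy[N' hN']; exists N' => n Nn; rewrite Tw; apply: hN'.
  by rewrite (leq_trans Nn) ?leq_addr.
have wz : cvg (fun n => w (phi n)) (y + K z).
  have := cvgD HA HE (cvg_subseq hp Twy) hz.
  by under eq_fun do rewrite /T /IminusC subrK.
exists (y + K z); apply: (cvg_unique HA HE (u := fun n => T (w (phi n)))).
  exact: cvg_subseq hp Twy.
exact: (cvg_image HA HE aT bT wz).
Qed.

Lemma iter_IminusC_compact K n : compact K ->
  exists Kn, compact Kn /\ forall x, iter n (IminusC K) x = IminusC Kn x.
Proof.
move=> cK; elim: n => [|n [Kn [cKn hKn]]].
  exists (fun=> 0); split; first exact (finite_rank_compact HA HE (finite_rank0 act ip)).
  by move=> x; rewrite /IminusC subr0.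
(* From [(I - K)(I - Kn) = I - (Kn + K (I - Kn))]. *)
exists (fun x => Kn x + K (IminusC Kn x)); split.
  apply: (compactD HA HE cKn); apply: (compact_comp HA HE cK).
    by apply: adjointable_IminusC; case: cKn.
  exact: bounded_IminusC (compact_bounded HA HE cKn).
by move=> x; rewrite iterS hKn /IminusC opprD addrA.
Qed.

(** If the ranges decreased strictly for ever, Riesz's lemma would give unit vectors [u n] in the
    range of [T^n] at distance at least 1/2 from that of [T^(n+1)]; the vectors [K (u n)] would then
    stay apart, against compactness. *)
Lemma range_stabilises K : compact K -> exists n, forall x, exists y,
  iter n (IminusC K) x = iter n.+1 (IminusC K) y.
Proof.
move=> cK; set T := IminusC K.
have aT : adjointable T by apply: adjointable_IminusC; case: cK.
have iterA n : adjointable (iter n T).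
  elim: n => [|n ih]; first by exists id.
  by have := adjointable_comp aT ih.
have ran_le m n x : (m <= n)%N -> exists y, iter n T x = iter m T y.
  by move=> mn; exists (iter (n - m) T x); rewrite -iterD subnKC.
apply: contrapT => hn.
have /choice[u hu] : forall n, exists u, [/\ exists x, u = iter n T x, h u = 1 &
    forall y, 1 <= 2 * h (u - iter n.+1 T y)].
  move=> n; apply: contrapT => hu; apply: hn; exists n => x.
  apply: contrapT => hx.
  have [|t y z [y' ->] [z' ->]|w y Tw hw| |m [t [[m' Tm] h1 h2]]] :=
    @riesz_lemma (fun k => exists y, k = iter n.+1 T y) (iter n T x).
  - by exists 0; rewrite (adjointable0 HA HE (iterA n.+1)).
  - exists (y' + real_complex R t *: z').
    by rewrite (adjointableD HA HE _ _ (iterA n.+1)) (adjointableZ HA HE _ _ (iterA n.+1)).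
  - have [Kn [cKn hKn]] := iter_IminusC_compact n.+1 cK.
    have /choice[w' hw'] := Tw.
    have [|v ->] := @IminusC_closed_range Kn w' y cKn; last by exists v; rewrite hKn.
    by under eq_fun do rewrite -hKn -hw'.
  - by move=> [y hy]; apply: hx; exists y.
  apply: hu; exists (real_complex R t *: (iter n T x - m)); split=> //.
    exists (real_complex R t *: (x - T m')).
    by rewrite (adjointableZ HA HE _ _ (iterA n)) (adjointableB HA HE _ _ (iterA n)) Tm iterSr.
  by move=> y; apply: h2; exists y.
have hu1 n : h (u n) <= 1 by have [_ -> _] := hu n.
have [phi [z [hp [_ hz]]]] := compact_seq cK hu1.
have h8 : 0 < 8^-1 :> R by lra.
have [N hN] := hz _ h8.
have hN1 := hN N (leqnn _); have hN2 := hN N.+1 (leqnSn _).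
have lt := hp N; set a := phi N in lt hN1; set b := phi N.+1 in lt hN2.
have [[xb hxb] _ _] := hu b; have [[xa hxa] _ sep] := hu a.
(* Since [a < b], [T (u a) + (u b - T (u b))] lies in the range of [T^(a+1)], and [u a] minus it is
   [K (u a) - K (u b)]. The tolerance 1/8 makes twice the norm of this smaller than 1. *)
have := sep (xa + iter (b - a.+1) T (xb - T xb)).
have -> : iter a.+1 T (xa + iter (b - a.+1) T (xb - T xb)) = T (u a) + (u b - T (u b)).
  rewrite (adjointableD HA HE _ _ (iterA a.+1)) -iterD subnKC//.
  rewrite (adjointableB HA HE _ _ (iterA b)) -iterSr !iterS.
  by rewrite -hxa -hxb.
have -> : u a - (T (u a) + (u b - T (u b))) = (K (u a) - K z) - (K (u b) - K z).
  rewrite [in RHS]opprB subrKA /T /IminusC [u b - (u b - _)]subKr.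
  by rewrite opprD addrA subKr.
have := hnormB HA HE (K (u a) - K z) (K (u b) - K z); lra.
Qed.

(** Stable ranges give [T^n x = T^(2n+1) y]. Then [x - T^(n+1) y] is killed by [T^n], hence by [T],
    the kernels being stable. *)
Lemma compact_decomposition K : compact K ->
  (forall x, IminusC K (IminusC K x) = 0 -> IminusC K x = 0) ->
  forall x, exists y z, IminusC K y = 0 /\ x = y + IminusC K z.
Proof.
move=> cK hker x; set T := IminusC K in hker *.
have aT : adjointable T by apply: adjointable_IminusC; case: cK.
have iterA n : adjointable (iter n T).
  elim: n => [|n ih]; first by exists id.
  by have := adjointable_comp aT ih.
have kerT n w : iter n T w = 0 -> T w = 0.
  elim: n => [|[|n] ih] //; last by move=> /= /hker.
  by move=> /= ->; exact (adjointable0 HA HE aT).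
have [n hn] := range_stabilises cK; rewrite -/T in hn.
have hk k : exists y, iter n T x = iter (k + n) T y.
  elim: k => [|k [y hy]]; first by exists x.
  have [y' hy'] := hn y; exists y'.
  by rewrite hy iterD hy' -iterD addnS.
have [y hy] := hk n.+1.
exists (x - T (iter n T y)), (iter n T y); split; last by rewrite subrK.
apply: (kerT n); rewrite (adjointableB HA HE _ _ (iterA n)) hy.
by rewrite -iterSr -iterD subrr.
Qed.

End RieszTheory.

(** * The projection onto the kernel *)

Section KernelProjection.
Variables (R : realType) (A : algType R[i]) (star : A -> A) (nA : A -> R).
Variables (E : lmodType R[i]) (act : E -> A -> E) (ip : E -> E -> A).
Hypotheses (HA : cstar_algebra star nA) (HE : hilbert_module star nA act ip).
Hypothesis HH : property_H nA ip.
Implicit Types (x y z v : E) (t : R) (T K P : E -> E).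
Local Notation h := (hnorm nA ip).
Local Notation compact := (compact_op nA act ip).

(** The Fredholm alternative: the kernel component in the decomposition vanishes. *)
Lemma compact_injective_surjective K : compact K ->
  (forall x, IminusC K x = 0 -> x = 0) -> forall y, exists x, IminusC K x = y.
Proof.
move=> cK inj y.
have [|x [z [/inj -> ->]]] := compact_decomposition HA HE HH cK _ y.
  by move=> x; exact: inj.
by exists z; rewrite add0r.
Qed.

(** The vector [(I - K') y] is orthogonal to [Ker (I - K)], and to [Ran (I - K)] as soon as [I - K']
    kills it; together these span [E]. *)
Lemma adjoint_kernel_stable K K' : compact K ->
  (forall x y, ip (K x) y = ip x (K' y)) ->
  (forall x, IminusC K (IminusC K x) = 0 -> IminusC K x = 0) ->
  forall x, IminusC K' (IminusC K' x) = 0 -> IminusC K' x = 0.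
Proof.
move=> cK adj hker y hy; apply: (ip_extr HE) => x; rewrite (ip0r HE).
have adjT u v : ip (IminusC K u) v = ip u (IminusC K' v).
  by rewrite /IminusC (ipBl HA HE) (ipBr HE) adj.
have [k [z [Tk ->]]] := compact_decomposition HA HE HH cK hker x.
by rewrite (ipDl HA HE) -adjT Tk (ip0l HA HE) add0r adjT hy (ip0r HE).
Qed.

(* If [P] were unbounded, normalised vectors [w n -> 0] with [|P (w n)| = 1]
   would exist; [P (w n) -> 0] weakly since [P] has an adjoint, hence
   [P (w n) = K (P (w n)) -> 0] in norm along a subsequence. *)
Lemma bounded_of_compact_fixed K P : compact K -> adjointable ip P ->
  (forall x, P x = K (P x)) -> bounded_op nA ip P.
Proof.
move=> cK aP hP; apply: contrapT => hn.
have /choice[w hw] : forall n : nat, exists w, h (P w) = 1 /\ h w <= n.+1%:R^-1.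
  move=> n; apply: contrapT => hw; apply: hn; exists n.+1%:R; split=> // x.
  rewrite leNgt; apply/negP => hlt.
  have p0 : 0 < h (P x) by apply: le_lt_trans hlt; rewrite mulr_ge0 ?hnorm_ge0.
  apply: hw; exists (real_complex R (h (P x))^-1 *: x).
  rewrite (adjointableZ HA HE _ _ aP) !(hnormZr HA HE) gtr0_norm ?invr_gt0//.
  split; first by rewrite mulVf// gt_eqF.
  by rewrite mulrC ler_pdivrMr// ler_pdivlMl// ltW.
have hw1 n : h (P (w n)) <= 1 by rewrite (proj1 (hw n)).
have [phi [z [hp [hz1 hz2]]]] := compact_seq HA HE HH cK hw1.
have z0 : z = 0.
  apply: (ip_extr HE) => v; rewrite (ip0r HE).
  apply: (converges_unique HA (hz1 v)) => e e0.
  have [P' hP'] := aP; pose B := 6 * h (P' v) + 1.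
  have B0 : 0 < B by have := hnorm_ge0 nA ip (P' v); rewrite /B; lra.
  have [N hN] := inv_nat_lt (divr_gt0 e0 B0).
  exists N => n Nn; rewrite subr0 (hm_ip_sym HE) hP' -(hm_ip_sym HE).
  apply: le_lt_trans (nA_ip_le HA HE _ _) _.
  have := hN _ (leq_trans Nn (le_subseq hp n)).
  have := proj2 (hw (phi n)); rewrite ltr_pdivlMr//.
  have := hnorm_ge0 nA ip (w (phi n)); have := hnorm_ge0 nA ip (P' v); rewrite /B.
  set p := _^-1; nra.
have h2 : 0 < 2^-1 :> R by lra.
have [N hN] := hz2 _ h2; have := hN N (leqnn _).
have aK := compact_adjointable cK.
by rewrite z0 (adjointable0 HA HE aK) subr0 -hP (proj1 (hw _)); lra.
Qed.

(** The adjoint of [P] is the kernel component [Q] for [I - K']: values of [P] are orthogonal to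
    [Ran (I - K')], and values of [Q] to [Ran (I - K)]. This makes [P] bounded, and [P = K P]
    compact. *)
Lemma kernel_projection_compact K P : compact K ->
  (forall x, IminusC K (IminusC K x) = 0 -> IminusC K x = 0) ->
  (forall x, IminusC K (P x) = 0) -> (forall x, exists u, x - P x = IminusC K u) ->
  compact P.
Proof.
move=> cK hker kerP ranP.
have [K' adj] := compact_adjointable cK.
have adjT u v : ip (IminusC K u) v = ip u (IminusC K' v).
  by rewrite /IminusC (ipBl HA HE) (ipBr HE) adj.
have cK' := compact_adjoint HA HE cK adj.
have hker' := adjoint_kernel_stable cK adj hker.
have /choice[Q hQ] := compact_decomposition HA HE HH cK' hker'.
have PK x : P x = K (P x).
  by apply/eqP; rewrite -subr_eq0; apply/eqP; exact: kerP.
have aP : adjointable ip P.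
  exists Q => x y; have [w [Qy yE]] := hQ y; have [u xE] := ranP x.
  rewrite {1}yE (hm_ip_add HE) -adjT kerP (ip0l HA HE) addr0.
  by rewrite -[x in RHS](subrK (P x)) xE (ipDl HA HE) adjT Qy (ip0r HE) add0r.
have -> : P = fun x => K (P x) by apply: funext.
exact: (compact_comp HA HE cK aP (bounded_of_compact_fixed cK aP PK)).
Qed.

(* With [F] of finite rank close to the projection [P], the operator
   [I - (P - F)] is injective, hence onto; applying [P] to [x = w - P w + F w]
   shows that the kernel is generated by the [P (xs i)]. *)
Lemma kernel_finitely_generated K : compact K ->
  (forall x, IminusC K (IminusC K x) = 0 -> IminusC K x = 0) ->
  finitely_generated act (fun x => IminusC K x = 0).
Proof.
move=> cK hker.
have /choice[P hP] := compact_decomposition HA HE HH cK hker.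
have kerP x : IminusC K (P x) = 0 by have [z []] := hP x.
have ranP x : exists u, x - P x = IminusC K u.
  by have [u [_ {1}->]] := hP x; exists u; rewrite addrAC subrr add0r.
have cP := kernel_projection_compact cK hker kerP ranP.
have aP := compact_adjointable cP.
have aT := adjointable_IminusC HA HE (compact_adjointable cK).
(* The difference [x - P x] lies both in the kernel and in the range of [I - K], which meet only in
   0 by [hker]. *)
have Pid x : IminusC K x = 0 -> P x = x.
  move=> Tx; have [u xE] := ranP x; apply/esym/eqP; rewrite -subr_eq0 xE.
  apply/eqP/hker; rewrite -xE (adjointableB HA HE _ _ aT) Tx kerP.
  exact: subrr.
have h2 : 0 < 2^-1 :> R by lra.
have [_ /(_ _ h2)[F [fF hF]]] := cP.
have cPF := compactD HA HE cP (finite_rank_compact HA HE (finite_rankN HE fF)).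
have inj x : IminusC (fun z => P z - F z) x = 0 -> x = 0.
  move=> /eqP; rewrite subr_eq0 => /eqP hx; apply: (hnorm_eq0 HA HE).
  have := hF x; rewrite -hx; have := hnorm_ge0 nA ip x; lra.
have surj := compact_injective_surjective cPF inj.
have [n [l [xs [ys FE]]]] := fF.
exists n, (fun i => P (xs i)) => x; split=> [Tx|[a ->]]; last first.
  rewrite (adjointable_sum HA HE _ aT) big1// => i _.
  rewrite (adjointable_act HA HE _ _ aT) kerP.
  by apply: (ip_extl HE) => v; rewrite (ip_actl HA HE) (ip0l HA HE) mulr0.
have [w hw] := surj x; exists (fun i => l i *: ip (ys i) w).
rewrite -(Pid x Tx) -hw /IminusC !(adjointableB HA HE _ _ aP) (Pid _ (kerP w)) subKr.
rewrite FE (adjointable_sum HA HE _ aP); apply: eq_bigr => i _.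
by rewrite (adjointableZ HA HE _ _ aP) (adjointable_act HA HE _ _ aP) (hm_act_scaler HE).
Qed.

End KernelProjection.

(** * Application to the powers of [I - C] *)

Theorem theorem3p11 (R : realType) (A : algType R[i]) (star : A -> A) (nA : A -> R)
  (E : lmodType R[i]) (act : E -> A -> E) (ip : E -> E -> A)
  (HA : cstar_algebra star nA)
  (HE : hilbert_module star nA act ip)
  (HH : property_H nA ip)
  (C : E -> E) (HC : compact_op nA act ip C)
  (r : nat)
  (Hr : forall x, ker_pow C r x <-> ker_pow C r.+1 x)
  (Hrmin : forall k, (k < r)%N -> ~ (forall x, ker_pow C k x <-> ker_pow C k.+1 x)) :
  [/\ (* E = Ker(L^r) (+) Ran(L^r) *)
      (forall x, ker_pow C r x -> ran_pow C r x -> x = 0),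
      (forall x, exists y z, [/\ ker_pow C r y, ran_pow C r z & x = y + z]),
      (* (1) *)
      finitely_generated act (ker_pow C r) &
      (forall P : E -> E,
         (forall x, ker_pow C r (P x) /\ ran_pow C r (x - P x)) ->
         (* (1) *) compact_op nA act ip P /\
         (* (2) *) bijective (fun x => x - C x - P x))].
Proof.
have [K [cK hK]] := iter_IminusC_compact HA HE r HC.
have aK := adjointable_IminusC HA HE (compact_adjointable cK).
have kerE : ker_pow C r = fun x => IminusC K x = 0.
  by apply: funext => x; rewrite /ker_pow hK.
(* The kernels stay constant from [r] on; taking [k = r] gives the stability that the theory
   requires of [I - K = L^r]. *)
have kerS k x : ker_pow C (k + r) x -> ker_pow C r x.
  elim: k x => [//|k ih] x hx; apply/Hr.
  rewrite /ker_pow iterSr; apply: ih.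
  by move: hx; rewrite /ker_pow addSn iterSr.
have hker x : IminusC K (IminusC K x) = 0 -> IminusC K x = 0.
  by rewrite -!hK -iterD; exact: kerS.
have disj x : ker_pow C r x -> ran_pow C r x -> x = 0.
  rewrite kerE => Tx [y yE]; move: Tx; rewrite yE hK; exact: hker.
split=> //.
- move=> x; have [y [z [Ty xE]]] := compact_decomposition HA HE HH cK hker x.
  by exists y, (IminusC K z); split=> //; [rewrite kerE | exists z; rewrite hK].
- by rewrite kerE; exact: (kernel_finitely_generated HA HE HH cK hker).
move=> P hP.
have kerP x : IminusC K (P x) = 0 by have [] := hP x; rewrite kerE.
have ranP x : exists u, x - P x = IminusC K u.
  by have [_ [u ->]] := hP x; exists u; rewrite hK.
have cP := kernel_projection_compact HA HE HH cK hker kerP ranP.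
split=> //.
have Pid x : ker_pow C r x -> P x = x.
  rewrite kerE => Tx; apply/esym/eqP; rewrite -subr_eq0; apply/eqP.
  apply: disj; last exact: (proj2 (hP x)).
  by rewrite kerE (adjointableB HA HE _ _ aK) Tx kerP subrr.
have cCP := compactD HA HE HC cP.
have aCP := adjointable_IminusC HA HE (compact_adjointable cCP).
have fE : (fun x => x - C x - P x) = IminusC (fun x => C x + P x).
  by apply: funext => x; rewrite /IminusC opprD addrA.
(* If [L x = P x], then [x] lies in [Ker L^(r+1) = Ker L^r], so [P x = x] and [L x = x]. Hence
   [x = L^r x = 0]. *)
have inj x : IminusC (fun x => C x + P x) x = 0 -> x = 0.
  rewrite -fE => /eqP; rewrite subr_eq0 => /eqP hx.
  have kx : ker_pow C r x.
    by apply/Hr; rewrite /ker_pow iterSr {2}/IminusC hx; exact: (proj1 (hP x)).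
  have {}hx : IminusC C x = x by rewrite /IminusC hx; exact: Pid.
  by move: kx; rewrite /ker_pow; elim: (r) => [|k ih] //; rewrite iterSr hx.
have /choice[g hg] := compact_injective_surjective HA HE HH cCP inj.
rewrite fE; exists g => // x.
apply/eqP; rewrite -subr_eq0; apply/eqP/inj.
by rewrite (adjointableB HA HE _ _ aCP) hg subrr.
Qed.
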